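(* For $n\ge 0$ let $a(n)$ be the number of compositions of $n$ that avoid the composition $34543$ (i.e. $3\,4\,5\,4\,3$). Then $$\sum_{n=0}^{\infty} a(n)\,x^n = -\frac{1-4x+6x^{2}-4x^{3}+x^{4}+x^{16}+x^{13}-x^{14}+x^{9}-2x^{10}+x^{11}+x^{5}-3x^{6}+3x^{7}-x^{8}}{x^{18}+x^{17}-x^{16}+2x^{14}-x^{13}-2x^{11}+3x^{10}-x^{9}+2x^{8}-5x^{7}+4x^{6}-x^{5}-2x^{4}+7x^{3}-9x^{2}+5x-1}.$$ The first 31 terms $a(0),\dots,a(30)$ are $1, 1, 2, 4, 8, 16, 32, 64, 128, 256, 512, 1024, 2048, 4096, 8192, 16384, 32768, 65536, 131072, 262143, 524281, 1048546, 2097050, 4194001, 8387784, 16775108, 33549270, 67096623, 134189393, 268371074, 536726740$. Moreover $\lim_{n\to\infty} a(n+1)/a(n) = r$ with $r = 1.99994300442\ldots$, and $a(n)\sim c\, r^n$ with $c = 0.50029301491\ldots$.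
   Context: A composition of a non-negative integer $n$ is a finite ordered list $a_1 a_2\cdots a_k$ of positive integers with $a_1+\cdots+a_k=n$ (the empty composition is the unique composition of $0$). A composition $a_1\cdots a_k$ includes (contains) the composition $b_1\cdots b_s$ if $k\ge s$ and there exists $i$ with $1\le i\le k-s+1$ such that $b_j\le a_{i+j-1}$ for all $j=1,\dots,s$. It avoids $b_1\cdots b_s$ if it does not include it. The decimal constants are given by their printed initial digits.
   Formalization: The printed c = 0.50029301491… is rounded (c ≈ 0.500293014909, so its initial digits are 0.50029301490); the formal theorem states that r and c each lie within 10^-11 of their printed decimals instead of having them as initial digits. *)

(* Defs.v *)
From Stdlib Require Import Reals NArith.
From HB Require Import structures.
From mathcomp Require Import all_boot all_order all_algebra.
From mathcomp Require Import all_classical all_reals all_analysis.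
From mathcomp Require Import Rstruct Rstruct_topology.

Set Implicit Arguments.
Unset Strict Implicit.
Unset Printing Implicit Defensive.

Definition is_comp (n : nat) (s : seq nat) : bool :=
  all (fun x => 0 < x)%N s && (sumn s == n).

Definition includes (a b : seq nat) : bool :=
  (size b <= size a)%N &&
  has (fun i => all (fun j => nth 0 b j <= nth 0 a (i + j))%N (iota 0 (size b)))
      (iota 0 (size a - size b).+1).

Definition avoids (a b : seq nat) : bool := ~~ includes a b.

Definition pat34543 : seq nat := [:: 3; 4; 5; 4; 3]%N.

(* Every composition of n has at most n parts, each at most n, so the
   compositions of n are in bijection with the elements x of the finite type
   below such that the list of values of the tuple (tagged x) is a
   composition of n (the tag is the length of that list). *)
Definition cand (n : nat) : finType := {k : 'I_n.+1 & k.-tuple 'I_n.+1}.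

Definition cand_seq (n : nat) (x : cand n) : seq nat := map val (tagged x).

Definition a (n : nat) : nat :=
  #|[pred x : cand n | is_comp n (cand_seq x) && avoids (cand_seq x) pat34543]|.

Local Open Scope ring_scope.

Definition Npoly : {poly int} :=
  1 - 4 *: 'X + 6 *: 'X^2 - 4 *: 'X^3 + 'X^4 + 'X^16 + 'X^13 - 'X^14 + 'X^9
  - 2 *: 'X^10 + 'X^11 + 'X^5 - 3 *: 'X^6 + 3 *: 'X^7 - 'X^8.

Definition Dpoly : {poly int} :=
  'X^18 + 'X^17 - 'X^16 + 2 *: 'X^14 - 'X^13 - 2 *: 'X^11 + 3 *: 'X^10 - 'X^9
  + 2 *: 'X^8 - 5 *: 'X^7 + 4 *: 'X^6 - 'X^5 - 2 *: 'X^4 + 7 *: 'X^3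
  - 9 *: 'X^2 + 5 *: 'X - 1.

Local Close Scope ring_scope.
Local Open Scope R_scope.

(* the printed decimal constants, and the tolerance 10^-11 (one unit in the
   last printed digit) *)
Definition r_printed : R := 1.99994300442.
Definition c_printed : R := 0.50029301491.
Definition tol : R := 1e-11.

(* Main.v *)
Require Import Defs.
From Stdlib Require Import Reals NArith Lra.
From HB Require Import structures.
From mathcomp Require Import all_boot all_order all_algebra.
From mathcomp Require Import all_classical all_reals all_analysis.
From mathcomp Require Import Rstruct Rstruct_topology.
From mathcomp Require Import zify ring ssrZ lra.

(** A five-state automaton recognises the compositions avoiding 34543. Counting the
words accepted from each state gives linear equations between power series;
eliminating all but one of them yields D(x) A(x) = -N(x).

For the growth, D has a simple root x = 1/r near 1/2. Multiplying D by a suitable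
polynomial M gives T = -1 + 2x + (terms of degree at least 11), whose linear term
dominates on the disc of radius 11/20. Hence the increments of s(n) = a(n) x^n
decay geometrically and s(n) converges. Its limit c is the residue c = N(x) / (x D'(x)),
and both constants are located by enclosing x in an interval of length 10^-17. *)

Set Implicit Arguments.
Unset Strict Implicit.
Unset Printing Implicit Defensive.
Import Order.TTheory GRing.Theory Num.Theory numFieldNormedType.Exports.

(** * Enumeration of compositions *)

Definition incr_head (s : seq nat) : option (seq nat) :=
  if s is h :: t then Some (h.+1 :: t) else None.

(** A nonempty composition either starts with 1 or comes from a smaller one by raising its first
    part. Unlike a recursion on the first part, this only refers to the preceding total. *)
Fixpoint comps (n : nat) : seq (seq nat) :=
  if n is m.+1 then map (cons 1) (comps m) ++ pmap incr_head (comps m)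
  else [:: [::]].

Lemma mem_comps (n : nat) (s : seq nat) : (s \in comps n) = is_comp n s.
Proof.
elim: n s => [|n IHn] s.
  by rewrite /is_comp inE; case: s => [|[|h] t] //=; rewrite andbF.
rewrite /= mem_cat mem_pmap.
case: s => [|h t].
  by rewrite [RHS]/is_comp /=; have [/orP[/mapP[]|/mapP[[]]]|] := boolP (_ || _).
apply/orP/idP => [[/mapP[s sn [-> ->]]|/mapP[[|h' t'] sn //= [-> ->]]]|].
- by move: sn; rewrite IHn /is_comp /= => /andP[-> /eqP->]; rewrite add1n eqxx.
- by move: sn; rewrite IHn /is_comp /= => /andP[/andP[_ ->] /eqP<-]; rewrite addSn eqxx.
case: h => [//|[|h]] /=; rewrite /is_comp /= => /andP[tpos sumt].
  by left; apply/mapP; exists t; rewrite // IHn /is_comp tpos.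
by right; apply/mapP; exists (h.+1 :: t); rewrite // IHn /is_comp /= tpos.
Qed.

Lemma comps_uniq (n : nat) : uniq (comps n).
Proof.
elim: n => [//|n IHn] /=; rewrite cat_uniq map_inj_uniq ?IHn; last by move=> ? ? [].
rewrite andTb; apply/andP; split.
  apply/hasPn => s; rewrite mem_pmap => /mapP[[|h t] //= sn [->]].
  apply/negP => /mapP[s' _ [h0 _]].
  by move: sn; rewrite mem_comps h0.
pose decr_head s := if s is h.+1 :: t then h :: t else [::].
apply: (@pmap_uniq _ _ _ (fun s : seq nat => decr_head s)) => //.
by case.
Qed.

Lemma a_comps (n : nat) : a n = count (fun s => avoids s pat34543) (comps n).
Proof.
rewrite /a cardE -(size_map (@cand_seq n)) -size_filter.
apply/perm_size/uniq_perm.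
- rewrite map_inj_uniq ?enum_uniq // => -[k s] [l t] /= eq_st.
  have eq_kl : k = l.
    by apply/val_inj; have := congr1 size eq_st; rewrite !size_map !size_tuple.
  by subst l; congr existT; apply/val_inj/(inj_map val_inj).
- exact/filter_uniq/comps_uniq.
move=> s; rewrite mem_filter mem_comps andbC.
apply/mapP/andP => [[x]|[sn av]].
  by rewrite mem_enum => /andP[? ?] ->.
have /andP[/allP spos /eqP sums] := sn.
have lt_sn i : (i \in s) -> (i < n.+1)%N.
  move=> /(nthP 0)[j ltj <-]; rewrite ltnS -sums -{2}[s](@cat_take_drop j).
  by rewrite sumn_cat (drop_nth 0 ltj) /=; lia.
have size_s : (size s < n.+1)%N.
  rewrite ltnS -sums {sn av lt_sn sums}.
  elim: s spos => //= h t IH pos.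
  have := pos h (mem_head _ _); have : (size t <= sumn t)%N.
    by apply: IH => i it; apply: pos; rewrite inE it orbT.
  by lia.
pose x : cand n := @Tagged _ (Ordinal size_s) (fun k : 'I_n.+1 => k.-tuple 'I_n.+1)
  (map_tuple (@inord n) (in_tuple s)).
have xs : cand_seq x = s.
  by rewrite /cand_seq /= -map_comp map_id_in // => i /lt_sn ?; exact: inordK.
by exists x; rewrite ?mem_enum ?inE xs ?sn.
Qed.

(** * The automaton *)

Fixpoint leads (b s : seq nat) : bool :=
  match b, s with
  | [::], _ => true
  | _ :: _, [::] => false
  | x :: b', y :: s' => (x <= y)%N && leads b' s'
  end.

Lemma leadsE (b s : seq nat) :
  leads b s = (size b <= size s)%N &&
    all (fun j => nth 0 b j <= nth 0 s j)%N (iota 0 (size b)).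
Proof.
elim: b s => [|x b IH] [|y s] //=.
rewrite IH ltnS -[1%N]addn0 iotaDl all_map.
by rewrite andbCA.
Qed.

Lemma includes_cons (b s : seq nat) (h : nat) :
  includes (h :: s) b = leads b (h :: s) || includes s b.
Proof.
rewrite /includes leadsE.
case: (leqP (size b) (size s)) => [le_bs|lt_sb].
  have -> : iota 0 (size (h :: s) - size b).+1 =
      0 :: map (addn 1) (iota 0 (size s - size b).+1).
    by rewrite -iotaDl /= subSn.
  by rewrite [has _ (_ :: _)]/= has_map leqW.
rewrite orbF; case: leqP => // le_bs.
by rewrite (eqP (_ : size (h :: s) - size b == 0)%N) /= ?orbF // subn_eq0.
Qed.

(* State [q] records the useful partial occurrences of 34543 that end at the last
   part read; 5 is the rejecting sink. *)
Definition step (q p : nat) : nat :=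
  match q with
  | 0 => if (2 < p)%N then 1 else 0
  | 1 => if (3 < p)%N then 2 else if (2 < p)%N then 1 else 0
  | 2 => if (4 < p)%N then 3 else if (3 < p)%N then 2 else if (2 < p)%N then 1 else 0
  | 3 => if (3 < p)%N then 4 else if (2 < p)%N then 1 else 0
  | 4 => if (2 < p)%N then 5 else 0
  | _ => 5
  end.

Definition accepts (q : nat) (s : seq nat) : bool := (foldl step q s < 5)%N.

Lemma accepts5 (s : seq nat) : accepts 5 s = false.
Proof. by rewrite /accepts; elim: s. Qed.

(** Overlapping partial occurrences leave several conditions on the unread suffix. This implication
    and the next two absorb the stronger ones, which is why so few states suffice. *)
Lemma leads_543_43 (s : seq nat) : leads [:: 5; 4; 3] s -> leads [:: 4; 3] s.
Proof. by case: s => [|x [|y [|z s]]] //=; lia. Qed.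

Lemma leads_4543_43 (s : seq nat) : leads [:: 4; 5; 4; 3] s -> leads [:: 4; 3] s.
Proof. by case: s => [|x [|y [|z [|t s]]]] //=; lia. Qed.

Lemma leads_4543_3 (s : seq nat) : leads [:: 4; 5; 4; 3] s -> leads [:: 3] s.
Proof. by case: s => [|x [|y [|z [|t s]]]] //=; lia. Qed.

(* What the unread suffix [s] still has to do, in state [q], to complete an
   occurrence of 34543 that starts in the part already read. *)
Definition pending (q : nat) (s : seq nat) : bool :=
  match q with
  | 0 => false
  | 1 => leads [:: 4; 5; 4; 3] s
  | 2 => leads [:: 4; 5; 4; 3] s || leads [:: 5; 4; 3] s
  | 3 => leads [:: 4; 3] s
  | 4 => leads [:: 3] s
  | _ => true
  end.

Lemma acceptsE (q : nat) (s : seq nat) :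
  accepts q s = ~~ (includes s pat34543 || pending q s).
Proof.
elim: s q => [|p s IH] q; first by case: q => [|[|[|[|[|[|q]]]]]].
rewrite {1}/accepts /= -/(accepts _ _) IH includes_cons.
have /implyP := @leads_543_43 s.
have /implyP := @leads_4543_43 s.
have /implyP := @leads_4543_3 s.
have lead34543 : leads pat34543 (p :: s) = (2 < p)%N && leads [:: 4; 5; 4; 3] s by [].
have lead4543 : leads [:: 4; 5; 4; 3] (p :: s) = (3 < p)%N && leads [:: 5; 4; 3] s by [].
have lead543 : leads [:: 5; 4; 3] (p :: s) = (4 < p)%N && leads [:: 4; 3] s by [].
have lead43 : leads [:: 4; 3] (p :: s) = (3 < p)%N && leads [:: 3] s by [].
have lead3 : leads [:: 3] (p :: s) = (2 < p)%N by rewrite /= andbT.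
have p43 : (4 < p)%N ==> (3 < p)%N by lia.
have p32 : (3 < p)%N ==> (2 < p)%N by lia.
(* A finite propositional check remains, over the thresholds on [p] and the [leads] conditions on
   [s]. *)
by case: q => [|[|[|[|[|q]]]]];
  rewrite /pending ?lead34543 ?lead4543 ?lead543 ?lead43 ?lead3 /step ?orbT //;
  move: (leads [:: 5; 4; 3] s) (leads [:: 4; 5; 4; 3] s) (leads [:: 4; 3] s);
  move: (leads [:: 3] s) (includes s _); move: p43 p32;
  case: (4 < p)%N; case: (3 < p)%N; case: (2 < p)%N => //= _ _; do 5![case] => //=.
Qed.

(** * The generating function *)

Definition naccept (q n : nat) : nat := count (accepts q) (comps n).

(* Raising the first part one unit at a time replaces the infinitely many possible
   first parts by the five thresholds that [step] can tell apart. *)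
Definition naccept_from (q j n : nat) : nat :=
  count (fun s => if s is h :: t then accepts (step q (j + h)) t else false)
    (comps n).

Lemma a_naccept (n : nat) : a n = naccept 0 n.
Proof. by rewrite a_comps; apply: eq_count => s; rewrite acceptsE orbF. Qed.

Lemma count_pmap_incr_head (P : pred (seq nat)) (ss : seq (seq nat)) :
  count P (pmap incr_head ss) =
  count (fun s => if s is h :: t then P (h.+1 :: t) else false) ss.
Proof. by elim: ss => [|[|h t] ss IH] //=; rewrite IH. Qed.

Lemma naccept0 (q : nat) : naccept q 0 = (q < 5)%N.
Proof. by rewrite /naccept /= addn0. Qed.

Lemma nacceptS (q n : nat) : naccept q n.+1 = naccept_from q 0 n.+1.
Proof.
by rewrite /naccept /naccept_from /= !count_cat !count_map !count_pmap_incr_head.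
Qed.

Lemma naccept_fromS (q j n : nat) :
  naccept_from q j n.+1 = (naccept (step q j.+1) n + naccept_from q j.+1 n)%N.
Proof.
rewrite /naccept /naccept_from /= count_cat count_map count_pmap_incr_head.
congr addn; first by apply: eq_count => s /=; rewrite addn1.
by apply: eq_count => -[|h t] //; rewrite addnS.
Qed.

Lemma step_ge5 (q p : nat) : step q (5 + p) = step q 5.
Proof. by case: q => [|[|[|[|[|]]]]]. Qed.

(** Parts of size at least 5 are indistinguishable for [step]; this closes the infinite family of
    recurrences in [j]. *)
Lemma naccept_from_ge4 (q j n : nat) :
  naccept_from q (4 + j) n = naccept_from q 4 n.
Proof.
elim: n j => // n IHn j; rewrite !naccept_fromS -addnS IHn (IHn 1).
by rewrite addnS -addSn step_ge5.
Qed.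

Local Open Scope ring_scope.

(** Power series are handled modulo ['X^N]: each identity below carries an explicit multiple of
    ['X^N] as error. *)
Definition trunc (N : nat) (u : nat -> nat) : {poly int} :=
  \poly_(i < N) (u i)%:Z.

Lemma trunc_shift (N : nat) (u v w : nat -> nat) :
    u 0%N = 0%N -> (forall n, u n.+1 = (v n + w n)%N) ->
  exists R, trunc N u = 'X * (trunc N v + trunc N w) + 'X^N * R.
Proof.
case: N => [|N] u0 uS.
  by exists 0; rewrite /trunc !poly_def !big_ord0 addr0 !mulr0 addr0.
(* Multiplication by ['X] pushes the top coefficients out of the truncation; this constant cancels
   them. *)
exists (- ((v N)%:Z + (w N)%:Z)%:P).
apply/polyP => i; rewrite coefD coefXM coefXnM coefN coefC coefD !coef_poly.
case: i => [|i] /=; first by rewrite u0 addr0.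
rewrite uS ltnS subSS subn_eq0 PoszD.
case: (ltngtP i N) => [lt_iN|lt_Ni|->].
- by rewrite ltnS (ltnW lt_iN) addr0.
- by rewrite ltnS leqNgt lt_Ni !addr0.
- by rewrite ltnSn subrr.
Qed.

(** Modulo ['X^N], the geometric sum is an inverse of [1 - 'X]. *)
Lemma cancel_1subX (N : nat) (P R : {poly int}) :
  (1 - 'X) * P = 'X^N * R -> exists R', P = 'X^N * R'.
Proof.
move=> PR; exists ((\sum_(i < N) 'X^i) * R + P).
have geom : 'X^N - 1 = ('X - 1) * \sum_(i < N) 'X^i :> {poly int} := subrX1 _ _.
rewrite mulrDr [_ * (_ * R)]mulrCA -PR.
transitivity ('X^N * P - ('X^N - 1) * P); last by rewrite geom; ring.
by ring.
Qed.

(** Split by the first part: 1 to 4 separately, while the parts from 5 on contribute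
    ['X^5 / (1 - 'X)]. The factor [1 - 'X] clears this denominator. *)
Lemma naccept_gf (N q : nat) : (q < 5)%N -> exists R,
  (1 - 'X) * trunc N (naccept q) =
  (1 - 'X) * (1 + 'X * trunc N (naccept (step q 1)) + 'X^2 * trunc N (naccept (step q 2))
    + 'X^3 * trunc N (naccept (step q 3)) + 'X^4 * trunc N (naccept (step q 4)))
  + 'X^5 * trunc N (naccept (step q 5)) + 'X^N * R.
Proof.
move=> q5.
have [R E] : exists R,
    trunc N (naccept q) = 1 + trunc N (naccept_from q 0) + 'X^N * R.
  (* For [N = 0] the truncation has no constant term, so the 1 must be cancelled. *)
  exists (- (N == 0%N)%:R); apply/polyP => i.
  rewrite !coefD coefXnM coefN !coef_poly coef1 -polyC_natr coefC subn_eq0.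
  case: N => [|N]; case: i => [|i] //=; first by rewrite naccept0 q5 addr0.
  by rewrite nacceptS; case: ifP => _; [rewrite addr0 | case: ifP].
have shift j := trunc_shift N (erefl : naccept_from q j 0 = 0%N) (naccept_fromS q j).
have [[R0 E0] [R1 E1] [R2 E2]] := And3 (shift 0%N) (shift 1%N) (shift 2%N).
have [[R3 E3] [R4 E4]] := conj (shift 3%N) (shift 4%N).
have G5 : trunc N (naccept_from q 5) = trunc N (naccept_from q 4).
  by apply/polyP => i; rewrite !coef_poly (naccept_from_ge4 q 1).
rewrite {}G5 in E4; rewrite {}E {}E0 {}E1 {}E2 {}E3.
exists ((1 - 'X) * (R + R0 + 'X * R1 + 'X^2 * R2 + 'X^3 * R3) + 'X^4 * R4).
(* Since the tails for 4 and 5 agree, [E4] now determines [1 - 'X] times that tail. *)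
have {}E4 : 'X * trunc N (naccept (step q 5)) =
    (1 - 'X) * trunc N (naccept_from q 4) - 'X^N * R4.
  by rewrite mulrBl mul1r {1}E4; ring.
rewrite (exprSr 'X 4) -[_ ^+ 4 * 'X * _]mulrA E4.
ring.
Qed.

Lemma Dpoly_trunc (N : nat) :
  exists R, Dpoly * trunc N a = - Npoly + 'X^N * R.
Proof.
have -> : trunc N a = trunc N (naccept 0).
  by apply/polyP => i; rewrite !coef_poly a_naccept.
have F5 : trunc N (naccept 5) = 0.
  apply/polyP => i; rewrite coef_poly coef0 /naccept (eq_count accepts5) count_pred0.
  by case: ifP.
have [e0] := @naccept_gf N 0 isT; have [e1] := @naccept_gf N 1 isT.
have [e2] := @naccept_gf N 2 isT; have [e3] := @naccept_gf N 3 isT.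
have [e4'] := @naccept_gf N 4 isT.
rewrite /step /= {}F5.
move: (trunc N (naccept 0)) (trunc N (naccept 1)) (trunc N (naccept 2)).
move: (trunc N (naccept 3)) (trunc N (naccept 4)) => F3 F4 F0 F1 F2.
move=> E4 /esym/(canRL (addKr _)) E3 /esym/(canRL (addKr _)) E2.
move=> /esym/(canRL (addKr _)) E1 /esym/(canRL (addKr _)) E0.
(* From state 4 every part above 2 leads to the sink, so no geometric tail survives and [1 - 'X]
   cancels. *)
have {E4 e4'} [e4 E4] : exists e4, F4 - (1 + ('X + 'X^2) * F0) = 'X^N * e4.
  apply: (@cancel_1subX N _ e4').
  by rewrite mulrBr E4; ring.
(* The multipliers come from eliminating [F1], [F2], [F3], [F4] in this order. *)
pose c0 : {poly int} := - ((1 - 'X) ^+ 3 * (1 - 'X^4) * (1 - 'X^3))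
  + (1 - 'X) ^+ 2 * 'X^7 + (1 - 'X) * 'X^12.
pose c1 : {poly int} := (1 - 'X) ^+ 2 * (1 - 'X^4) * 'X^3.
pose c2 : {poly int} := (1 - 'X) * 'X^7.
exists (c0 * e0 - c1 * e1 - c2 * e2 - 'X^12 * e3 - 'X^16 * e4).
transitivity (- Npoly + (c0 * ('X^N * e0) - c1 * ('X^N * e1) - c2 * ('X^N * e2)
    - 'X^12 * ('X^N * e3) - 'X^16 * ('X^N * e4))); last by ring.
rewrite E0 E1 E2 E3 -E4 /Dpoly /Npoly /c0 /c1 /c2 -!mul_polyC.
by ring.
Qed.

Lemma Poly_cons (R : nzSemiRingType) (x : R) (s : seq R) :
  Poly (x :: s) = Poly s * 'X + x%:P.
Proof. exact: cons_poly_def. Qed.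

Definition Dcoefs : seq int :=
  [:: -1; 5; -9; 7; -2; -1; 4; -5; 2; -1; 3; -2; 0; -1; 2; 0; -1; 1; 1].

Definition Ncoefs : seq int :=
  [:: 1; -4; 6; -4; 1; 1; -3; 3; -1; 1; -2; 1; 0; 1; -1; 0; 1].

Lemma DpolyE : Dpoly = Poly Dcoefs.
Proof.
by rewrite /Dpoly /Dcoefs -!mul_polyC !Poly_cons -[Poly [::]]/(0 : {poly int}); ring.
Qed.

Lemma NpolyE : Npoly = Poly Ncoefs.
Proof.
by rewrite /Npoly /Ncoefs -!mul_polyC !Poly_cons -[Poly [::]]/(0 : {poly int}); ring.
Qed.

Lemma a_gf (n : nat) :
  \sum_(k < n.+1) Dpoly`_k * (a (n - k))%:Z = - Npoly`_n.
Proof.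
have [R /(congr1 (fun p : {poly int} => p`_n))] := Dpoly_trunc n.+1.
rewrite coefD coefN coefXnM ltnSn addr0 coefM => <-.
by apply: eq_bigr => k _; rewrite coef_poly ltnS leq_subr.
Qed.

Fixpoint dotZ (d l : seq Z) : Z :=
  if d is x :: d' then if l is y :: l' then Z.add (Z.mul x y) (dotZ d' l') else Z0
  else Z0.

Lemma dotZE (d l : seq Z) : dotZ d l = \sum_(k < size l) d`_k * l`_k.
Proof.
elim: d l => [|x d IH] [|y l] /=; rewrite ?big_ord0 //.
  by rewrite big1 // => k _; rewrite nth_nil mul0r.
by rewrite big_ord_recl IH.
Qed.

(** The recurrence solved for its newest term, without division because the constant coefficient of
    [Dpoly] is -1. Storing the newest term first turns the convolution into a dot product. *)
Fixpoint revterms (n : nat) : seq Z :=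
  if n is m.+1 then
    let l := revterms m in
    Z.add (dotZ (map Z_of_int (behead Dcoefs)) l) (Z_of_int Ncoefs`_m) :: l
  else [::].

Lemma revtermsE (u : nat -> nat) (n : nat) :
    (forall n, \sum_(k < n.+1) Dcoefs`_k * (u (n - k)%N)%:Z = - Ncoefs`_n) ->
  revterms n = mkseq (fun k => Z.of_nat (u (n - k.+1)%N)) n.
Proof.
move=> rec; elim: n => [//|n IHn].
rewrite -[revterms n.+1]/(Z.add (dotZ (map Z_of_int (behead Dcoefs)) (revterms n))
  (Z_of_int Ncoefs`_n) :: revterms n).
rewrite [in RHS]/mkseq -[iota 0 n.+1]/(0%N :: iota 1 n) map_cons subSS subn0.
rewrite -[1%N]addn0 iotaDl -map_comp; congr (_ :: _).
  rewrite dotZE IHn size_mkseq.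
  have := congr1 Z_of_int (rec n); rewrite big_ord_recl subn0 rmorphD rmorphM rmorphN /=.
  rewrite rmorph_sum /= => E.
  set S1 := (\sum_(i < n) _ : Z) in E; set S2 := (\sum_(k < n) _ : Z).
  have -> : S2 = S1.
    apply: eq_bigr => k _; rewrite rmorphM /= nth_mkseq //; congr (_ * _).
    rewrite -[0 in LHS](rmorph0 Z_of_int).
    have [lt_k|le_k] := ltnP k (size (behead Dcoefs)); first by rewrite -(nth_map 0 0 Z_of_int).
    by rewrite !nth_default // size_map.
  by lia.
by rewrite IHn; apply: eq_map => k /=; rewrite add1n subSS.
Qed.

Lemma first_terms (u : nat -> nat) :
    (forall n, \sum_(k < n.+1) Dcoefs`_k * (u (n - k)%N)%:Z = - Ncoefs`_n) ->
  map (fun n => N.of_nat (u n)) (iota 0 31) =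
    [:: 1; 1; 2; 4; 8; 16; 32; 64; 128; 256; 512; 1024; 2048; 4096; 8192;
        16384; 32768; 65536; 131072; 262143; 524281; 1048546; 2097050;
        4194001; 8387784; 16775108; 33549270; 67096623; 134189393;
        268371074; 536726740]%num.
Proof.
move=> rec; transitivity (map Z.to_N (rev (revterms 31))); last by vm_compute.
rewrite (revtermsE 31 rec) -map_rev -map_comp.
have of_natE k : N.of_nat k = Z.to_N (Z.of_nat k) by rewrite -Znat.nat_N_Z Znat.N2Z.id.
by rewrite (eq_map (fun n => of_natE (u n))).
Qed.

(** * Dominant roots of linear recurrences *)

Local Open Scope classical_set_scope.

Definition cauchy_prod (R : pzSemiRingType) (p u : nat -> R) (n : nat) : R :=
  \sum_(k < n.+1) p k * u (n - k)%N.

(** Associativity of the product of series, read off the truncation [U], which is exact up to degree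
    [n]. *)
Lemma cauchy_prodM (R : comNzRingType) (m p nu : {poly R}) (u : nat -> R) :
    (forall n, cauchy_prod (nth 0 p) u n = nu`_n) ->
  forall n, cauchy_prod (nth 0 (m * p)) u n = (m * nu)`_n.
Proof.
move=> pu n; pose U := \poly_(i < n.+1) u i.
have cauchyU (q : {poly R}) j : (j <= n)%N -> cauchy_prod (nth 0 q) u j = (q * U)`_j.
  move=> le_jn; rewrite coefM; apply: eq_bigr => k _.
  by rewrite coef_poly ltnS (leq_trans (leq_subr _ _)).
rewrite cauchyU // -mulrA !coefM; apply: eq_bigr => k _.
by rewrite -cauchyU ?leq_subr // pu.
Qed.

Lemma sum_nth_trunc (R : pzSemiRingType) (p : seq R) (m : nat) (F : nat -> R) :
  (size p <= m)%N -> \sum_(k < m) p`_k * F k = \sum_(k < size p) p`_k * F k.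
Proof.
move=> le_pm; rewrite [RHS](big_ord_widen m (fun k => p`_k * F k)) //.
rewrite [RHS]big_mkcond; apply: eq_bigr => k _.
by case: ltnP => // le_pk; rewrite nth_default // mul0r.
Qed.

(* A Rouche-type criterion: where the linear coefficient dominates on the disc of
   radius [rho], [x] is the only root there, and the other modes decay faster. *)
Lemma dominant_root_step (R : realFieldType) (p : {poly R}) (u : nat -> R)
    (x rho : R) (n0 : nat) :
    0 < x -> x < rho -> root p x ->
    \sum_(2 <= k < size p) k%:R * `|p`_k| * rho ^+ k.-1 < `|p`_1| ->
    (forall n, (n0 <= n)%N -> cauchy_prod (nth 0 p) u n = 0) ->
  exists C, forall n,
    `|u n.+1 * x ^+ n.+1 - u n * x ^+ n| <= C * (x / rho) ^+ n.
Proof.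
move=> x0 xrho px0 small pu.
have rho0 : 0 < rho := lt_trans x0 xrho.
pose s n := u n * x ^+ n; pose e n := s n.+1 - s n.
pose t := rho / x; have t1 : 1 < t by rewrite /t ltr_pdivlMr // mul1r.
have t0 : 0 < t := lt_trans ltr01 t1.
pose n1 := maxn n0 (size p).
(* This bounds the early terms; from [n1] on the recurrence is homogeneous and all of [p] fits into
   it. *)
pose C := \sum_(j < n1) `|e j| * t ^+ j.
suff et n : `|e n| * t ^+ n <= C.
  exists C => n; rewrite -(ler_pM2r (exprn_gt0 n t0)) -mulrA -exprMn.
  by rewrite /t mulrA divfK ?gt_eqF // divff ?gt_eqF // expr1n mulr1 et.
have C0 : 0 <= C by apply: sumr_ge0 => j _; rewrite mulr_ge0 // exprn_ge0 // ltW.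
have [lt_n|le_n] := ltnP n n1.
  rewrite /C (bigD1 (Ordinal lt_n)) //= lerDl sumr_ge0 // => j _.
  by rewrite mulr_ge0 // exprn_ge0 // ltW.
elim/ltn_ind: n le_n => n IH le_n.
have {}IH j : (j < n)%N -> `|e j| * t ^+ j <= C.
  have [lt_j _|le_j lt_jn] := ltnP j n1; last exact: IH.
  rewrite /C (bigD1 (Ordinal lt_j)) //= lerDl sumr_ge0 // => i _.
  by rewrite mulr_ge0 // exprn_ge0 // ltW.
(* Otherwise [n] sets a new record, and every earlier increment is controlled by [e n]. *)
rewrite leNgt; apply/negP => gtC.
have le_e j : (j <= n)%N -> `|e j| <= `|e n| * t ^+ (n - j).
  rewrite leq_eqVlt => /predU1P[->|lt_jn]; first by rewrite subnn mulr1.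
  rewrite -(ler_pM2r (exprn_gt0 j t0)) -mulrA -exprD subnK; last exact: ltnW.
  by apply: le_trans (IH _ lt_jn) _; exact: ltW.
have en0 : 0 < `|e n|.
  by rewrite -(pmulr_lgt0 _ (exprn_gt0 n t0)); exact: le_lt_trans C0 gtC.
have size_n : (size p <= n)%N by rewrite (leq_trans _ le_n) // leq_maxr.
have sump : \sum_(k < size p) p`_k * x ^+ k = 0.
  by rewrite -horner_coef; exact/rootP.
(* The rescaled recurrence is subtracted from [s n.+1] times the vanishing value of [p] at [x]. *)
have rec : \sum_(k < size p) p`_k * x ^+ k * (s n.+1 - s (n.+1 - k)%N) = 0.
  under eq_bigr do rewrite mulrBr.
  rewrite big_split /= -mulr_suml sump mul0r add0r sumrN.
  apply/eqP; rewrite oppr_eq0; apply/eqP.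
  transitivity (cauchy_prod (nth 0 p) u n.+1 * x ^+ n.+1); last first.
    by rewrite pu ?mul0r // leqW // (leq_trans _ le_n) // leq_maxl.
  rewrite /cauchy_prod (@sum_nth_trunc _ p n.+2 (fun k => u (n.+1 - k)%N)); last by rewrite !leqW.
  rewrite mulr_suml; apply: eq_bigr => k _.
  rewrite /s -!mulrA; congr (_ * _); rewrite mulrCA -exprD subnKC //.
  by rewrite ltnW // ltnS (leq_trans (ltnW (ltn_ord k))).
have diff_le k : (k <= n.+1)%N ->
    `|s n.+1 - s (n.+1 - k)%N| <= k%:R * (`|e n| * t ^+ k.-1).
  move=> le_k.
  rewrite -telescope_sumr ?leq_subr //.
  apply: le_trans (ler_norm_sum _ _ _) _.
  have -> : k%:R * (`|e n| * t ^+ k.-1) = \sum_(n.+1 - k <= j < n.+1) `|e n| * t ^+ k.-1.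
    by rewrite sumr_const_nat subKn // mulr_natl.
  apply: ler_sum_nat => j /andP[le_j lt_j].
  apply: le_trans (le_e j _) _ => //.
  rewrite ler_pM2l // ler_eXn2l //.
  by rewrite leq_subLR; lia.
have size_p : (1 < size p)%N.
  rewrite ltnNge; apply/negP => le_p1.
  by move: small; rewrite big_geq ?nth_default ?normr0 ?ltxx // leqW.
(* The term k = 0 vanishes and k = 1 is a multiple of [e n]; by [small] the remaining terms are too
   small to balance it. *)
move: rec; rewrite -(big_mkord xpredT (fun k => p`_k * x ^+ k * (s n.+1 - s (n.+1 - k)%N))).
rewrite big_ltn ?(ltn_trans _ size_p) // big_ltn //.
rewrite subn0 subrr mulr0 add0r expr1 subn1 /= -/(e n) => /eqP; rewrite addr_eq0 => /eqP rec.
have := congr1 Num.norm rec; rewrite normrN !normrM (gtr0_norm x0) => rec'.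
suff : `|p`_1| * x * `|e n| < `|p`_1| * x * `|e n| by rewrite ltxx.
rewrite {1}rec'.
apply: (@le_lt_trans _ _ (x * `|e n| * \sum_(2 <= k < size p) k%:R * `|p`_k| * rho ^+ k.-1)); last first.
  by rewrite -[ltRHS]mulrA [ltRHS]mulrC ltr_pM2l ?mulr_gt0.
apply: le_trans (ler_norm_sum _ _ _) _; rewrite mulr_sumr; apply: ler_sum_nat => k /andP[k2 lt_k].
rewrite !normrM normrX (gtr0_norm x0).
apply: le_trans (ler_wpM2l _ (diff_le k _)) _.
- by rewrite mulr_ge0 // exprn_ge0 // ltW.
- exact: leqW (ltnW (leq_trans lt_k size_n)).
rewrite /t expr_div_n.
case: k k2 lt_k => // k k2 lt_k /=.
rewrite exprS le_eqVlt; apply/orP; left; apply/eqP; field.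
by rewrite expf_neq0 ?gt_eqF.
Qed.

Lemma geometric_increments_cvg (R : realType) (s : nat -> R) (C theta : R) :
    0 <= theta < 1 -> (forall n, `|s n.+1 - s n| <= C * theta ^+ n) ->
  exists c : R, s @ \oo --> c.
Proof.
move=> /andP[th0 th1] le_s.
have C0 : 0 <= C by have := le_s 0%N; rewrite mulr1; exact: le_trans.
have cvgS : cvgn (series (telescope s)).
  apply: normed_cvg; apply: series_le_cvg (le_s) _ => [n|n|].
  - exact: normr_ge0.
  - by rewrite mulr_ge0 // exprn_ge0.
  by apply: is_cvg_geometric_series; rewrite ger0_norm.
exists (s 0%N + lim (series (telescope s) @ \oo)).
rewrite [X in X @ _](_ : s = cst (s 0%N) + series (telescope s)).
  exact: cvgD (cvg_cst _) cvgS.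
by apply/funext => n; rewrite {1}eq_sum_telescope.
Qed.

(* Partial sums [S] of [u n * x ^+ n] turn the convolution into the identity
   [sum_k p_k x^k S(n + 1 - k) = sum_(i <= n) nu_i x^i]; since [p] vanishes at [x],
   [S(n + 1)] can be subtracted from every [S(n + 1 - k)] before the limit. *)
Lemma limit_at_root (R : realType) (p nu : {poly R}) (u : nat -> R) (x c : R) :
    root p x -> (forall n, cauchy_prod (nth 0 p) u n = nu`_n) ->
    (fun n => u n * x ^+ n) @ \oo --> c ->
  c * (p^`() * 'X).[x] = - nu.[x].
Proof.
move=> px0 pu; set s := fun n => _ => sc.
(* For k > n the natural subtraction yields the empty sum [series s 0], so the range of k may be any
   [K] above [n]. *)
have G K n : (n < K)%N ->
    \sum_(k < K) p`_k * x ^+ k * series s (n.+1 - k)%N = \sum_(i < n.+1) nu`_i * x ^+ i.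
  have inc m : (m < K)%N ->
     \sum_(k < K | (k < m.+1)%N) p`_k * x ^+ k * s (m - k)%N = nu`_m * x ^+ m.
    move=> lt_m; rewrite -pu /cauchy_prod mulr_suml.
    rewrite -(big_ord_widen K (fun k => p`_k * x ^+ k * s (m - k)%N)) //.
    apply: eq_bigr => k _; rewrite /s -!mulrA; congr (_ * _).
    by rewrite mulrCA -exprD subnKC // -ltnS.
  elim: n => [|n IHn] lt_n.
    rewrite big_ord1 -(inc 0%N) // [RHS]big_mkcond; apply: eq_bigr => k _.
    rewrite ltnS leqn0; case: (k : nat) => [|k'] /=.
      by rewrite seriesEnat /= subn0 big_nat1 subn0.
    by rewrite subSS sub0n seriesEnat /= big_geq // mulr0.
  rewrite big_ord_recr /= -(IHn (ltnW lt_n)) -(inc n.+1) // [X in _ + X]big_mkcond -big_split /=.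
  apply: eq_bigr => k _; case: ltnP => [le_k|lt_k].
    by rewrite -mulrDr subSn // !seriesEnat /= big_nat_recr.
  rewrite (eqP (_ : n.+2 - k == 0)%N) ?subn_eq0 //.
  by rewrite (eqP (_ : n.+1 - k == 0)%N) ?subn_eq0 ?addr0 // ltnW.
pose K := size p.
have sump : \sum_(k < K) p`_k * x ^+ k = 0.
  by rewrite -horner_coef; exact/rootP.
(* The inner sum is S(m + K + 1) - S(m + K + 1 - k), made of k terms that each tend to [c]. *)
have lims : (fun m => \sum_(k < K) p`_k * x ^+ k * \sum_(i < k) s (m + (K - i))%N) @ \oo
    --> \sum_(k < K) p`_k * x ^+ k * (\sum_(i < k) c).
  apply: cvg_big => [|k _]; first exact: add_continuous.
  apply: cvgM; first exact: cvg_cst.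
  apply: cvg_big => [|i _]; first exact: add_continuous.
  by rewrite (cvg_shiftn (K - i)%N).
have limc : (fun m => \sum_(k < K) p`_k * x ^+ k * \sum_(i < k) s (m + (K - i))%N) @ \oo
    --> - nu.[x].
  apply: cvg_near_cst; near=> m.
  have le_m : (size nu <= (m + K).+1)%N.
    by rewrite leqW // (leq_trans _ (leq_addr _ _)) //; near: m; exact: nbhs_infty_ge.
  rewrite horner_coef -(@sum_nth_trunc _ nu (m + K).+1 (fun i => x ^+ i)) //.
  rewrite -(G (m + K).+1) //; under [X in - X]eq_bigr do rewrite -mulrA.
  rewrite (@sum_nth_trunc _ p _ (fun k => x ^+ k * series s ((m + K).+1 - k)%N)); last first.
    by rewrite leqW // leq_addl.
  apply/eqP; rewrite -addr_eq0 -big_split /=; apply/eqP.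
  transitivity (\sum_(k < K) p`_k * x ^+ k * series s (m + K).+1); last first.
    by rewrite -mulr_suml sump mul0r.
  apply: eq_bigr => k _; rewrite mulrA -mulrDr; congr (_ * _).
  elim: (k : nat) (ltnW (ltn_ord k)) => [|j IHj] lt_j.
    by rewrite big_ord0 add0r subn0.
  rewrite -(IHj (ltnW lt_j)) big_ord_recr /= -addrA; congr (_ + _).
  have -> : ((m + K).+1 - j = ((m + K).+1 - j.+1).+1)%N by lia.
  rewrite seriesEnat /= big_nat_recr //= addrC.
  by congr (_ + s _); lia.
have <- := cvg_unique (@norm_hausdorff _ _) lims limc.
have -> : p^`() * 'X = \poly_(k < K) (p`_k *+ k).
  apply/polyP => -[|k]; rewrite coefMX coef_poly /= ?mulr0n ?if_same // coef_deriv.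
  by case: ltnP => // le_K; rewrite nth_default // mul0rn.
rewrite horner_poly mulr_sumr; apply: eq_bigr => k _.
by rewrite sumr_const card_ord mulrnAl !mulrnAr mulrC.
Unshelve. all: by end_near.
Qed.

(** * Numerical estimates *)

(* One has -D = (1 - 2x) W + x^16 (1 - x - x^2) for
   W = (1 - x)^3 + x^5 (1 - x)^2 + x^9 (1 - x) + x^13, and [Mcoefs] truncates 1/W. *)
Definition Mcoefs : seq int := [:: 1; 3; 6; 10; 15; 20; 24; 26; 25; 19; 6].

Definition Tcoefs : seq int :=
  [:: -1; 2; 0; 0; 0; 0; 0; 0; 0; 0; 0; -16; 31; 5; -9; 3; -14; 16; 24; 16; 3;
      20; 42; 50; 37; 32; 38; 25; 6].

Lemma Dpoly_mulM : Poly Mcoefs * Dpoly = Poly Tcoefs.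
Proof.
rewrite /Dpoly /Mcoefs /Tcoefs -!mul_polyC !Poly_cons -[Poly [::]]/(0 : {poly int}).
by ring.
Qed.

Definition derivXcoefs : seq int :=
  [:: 0; 5; -18; 21; -8; -5; 24; -35; 16; -9; 30; -22; 0; -13; 28; 0; -16; 17; 18].

Lemma Dpoly_derivX : Dpoly^`() * 'X = Poly derivXcoefs.
Proof.
apply/polyP => k; rewrite coefMX coef_deriv DpolyE !coef_Poly.
do 20 (case: k => [|k] //).
by rewrite /= mul0rn.
Qed.

(** [Dpoly] itself fails this test: its quadratic term alone gives 18 * 11/20 > 5. *)
Lemma Tcoefs_small (R : realFieldType) (p := map_poly intr (Poly Tcoefs) : {poly R}) :
  \sum_(2 <= k < size p) k%:R * `|p`_k| * (11 / 20) ^+ k.-1 < `|p`_1|.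
Proof.
have -> : size p = 29%N.
  rewrite /p size_map_poly_id0; first by rewrite (PolyK (c := 0)).
  by rewrite lead_coefE (PolyK (c := 0)) //= intr_eq0.
have pE k : `|p`_k| = (`|Tcoefs`_k|)%:~R.
  by rewrite coef_map coef_Poly intr_norm.
rewrite unlock /= !pE /= !(normrN, normr_nat, normr0).
lra.
Qed.

Local Open Scope R_scope.

Definition x_lo : R := 0.50001424930027572.
Definition x_hi : R := 0.50001424930027573.

(** Evaluation with [IZR] coefficients, a form that [Lra.lra] can process. *)
Fixpoint Zhorner (s : seq Z) (x : R) : R :=
  if s is z :: s' then Zhorner s' x * x + IZR z else 0.

Lemma intr_IZR (z : int) : (z%:~R = IZR (Z_of_int z) :> R)%R.
Proof.
have natE n : n%:R%R = IZR (Z.of_nat n) by rewrite -INRE INR_IZR_INZ.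
case: z => n; first exact: natE.
rewrite NegzE mulrNz -pmulrn natE -RoppE -Ropp_Ropp_IZR.
by congr IZR; lia.
Qed.

Lemma horner_map_intr (s : seq int) (x : R) :
  ((map_poly intr (Poly s)).[x])%R = Zhorner (map Z_of_int s) x.
Proof.
by rewrite map_Poly horner_Poly; elim: s => //= z s ->; rewrite -intr_IZR.
Qed.

Lemma root_exists :
  exists x, x_lo <= x <= x_hi /\ root (map_poly intr Dpoly : {poly R}) x.
Proof.
have lo : Zhorner (map Z_of_int Dcoefs) x_lo <= 0.
  by rewrite /= /x_lo; Lra.lra.
have hi : 0 <= Zhorner (map Z_of_int Dcoefs) x_hi.
  by rewrite /= /x_hi; Lra.lra.
have lohi : x_lo <= x_hi by rewrite /x_lo /x_hi; Lra.lra.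
rewrite DpolyE.
have [] := @poly_ivt R (map_poly intr (Poly Dcoefs)) x_lo x_hi.
- exact/RleP.
- by rewrite !horner_map_intr; apply/andP; split; exact/RleP.
move=> x /andP[/RleP ? /RleP ?] rx; exists x; split=> //.
Qed.

Lemma pow_bounds (x : R) (n : nat) :
  x_lo <= x <= x_hi -> x_lo ^ n <= x ^ n <= x_hi ^ n.
Proof.
move=> [lo hi]; have lo0 : 0 <= x_lo by rewrite /x_lo; Lra.lra.
by split; apply: pow_incr; split=> //; apply: Rle_trans lo.
Qed.

Lemma Rabs_lt (y e : R) : - e < y < e -> Rabs y < e.
Proof. by move=> ?; apply: Rabs_def1; Lra.lra. Qed.

Lemma growth_rate_bound (x : R) :
  x_lo <= x <= x_hi -> Rabs (/ x - r_printed) < tol.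
Proof.
rewrite /x_lo /x_hi => xb; have x0 : 0 < x by Lra.lra.
apply: Rabs_lt; split; apply: (Rmult_lt_reg_r x) => //.
  rewrite Rmult_minus_distr_r Rinv_l /r_printed /tol; Lra.lra.
rewrite Rmult_minus_distr_r Rinv_l /r_printed /tol; Lra.lra.
Qed.

Lemma constant_bound (x c : R) : x_lo <= x <= x_hi ->
    c * Zhorner (map Z_of_int derivXcoefs) x = Zhorner (map Z_of_int Ncoefs) x ->
  Rabs (c - c_printed) < tol.
Proof.
set Q := Zhorner _ x; set N := Zhorner _ x => xb cQ.
have b k := pow_bounds k xb.
(* The bounds to prove become linear in the powers of [x], each enclosed separately; degree 15
   occurs in neither polynomial. *)
have := b 1%N; have := b 2%N; have := b 3%N; have := b 4%N; have := b 5%N.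
have := b 6%N; have := b 7%N; have := b 8%N; have := b 9%N; have := b 10%N.
have := b 11%N; have := b 12%N; have := b 13%N; have := b 14%N; have := b 16%N.
have := b 17%N; have := b 18%N; rewrite /x_lo /x_hi => *.
have Q0 : 0 < Q by rewrite /Q /=; Lra.lra.
apply: Rabs_lt; split; apply: (Rmult_lt_reg_r Q) => //; rewrite Rmult_minus_distr_r cQ.
  by rewrite /Q /N /c_printed /tol /=; Lra.lra.
by rewrite /Q /N /c_printed /tol /=; Lra.lra.
Qed.

(** * Asymptotics *)

Local Close Scope R_scope.

Definition realize : {poly int} -> {poly R} := map_poly intr.

Lemma a_cauchy (n : nat) :
  cauchy_prod (nth 0 (realize Dpoly)) (fun n => (a n)%:R) n = (realize (- Npoly))`_n.
Proof.
rewrite coef_map coefN -a_gf /= (rmorph_sum intr) /=; apply: eq_bigr => k _.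
by rewrite rmorphM /= coef_map.
Qed.

Lemma weighted_a_cvg (x : R) : (x_lo <= x <= x_hi)%coqR ->
    root (realize Dpoly) x ->
  exists c : R, ((fun n => (a n)%:R * x ^+ n) @ \oo --> c)%classic.
Proof.
rewrite /x_lo /x_hi => xb Dx0.
have x0 : 0 < x by apply/RltP; rewrite -R0E; Lra.lra.
have xrho : x < 11 / 20.
  apply/RltP; have -> : 11 / 20 = Rdiv (IZR 11) (IZR 20).
    by congr (_ / _); [exact: (intr_IZR (Posz 11)) | exact: (intr_IZR (Posz 20))].
  by Lra.lra.
have rootT : root (realize (Poly Tcoefs)) x.
  by rewrite -Dpoly_mulM /realize rmorphM rootM Dx0 orbT.
have recT := cauchy_prodM (realize (Poly Mcoefs)) a_cauchy.
rewrite -rmorphM /= Dpoly_mulM in recT.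
(* From index [n0] on, the coefficients of the multiplied numerator are zero by default, so the
   recurrence is homogeneous. *)
have [C le_C] := dominant_root_step x0 xrho rootT (Tcoefs_small R)
  (n0 := size (realize (Poly Mcoefs) * realize (- Npoly)))
  (fun n (le_n : (_ <= n)%N) => etrans (recT n) (nth_default 0 le_n)).
apply: (geometric_increments_cvg _ le_C).
have rho0 := lt_trans x0 xrho.
by rewrite divr_ge0 ?(ltW x0) ?(ltW rho0) //= ltr_pdivrMr // mul1r.
Qed.

Local Close Scope ring_scope.

Theorem theorem1 :
  (* generating function, as an identity of formal power series:
     Dpoly(x) * (sum_n a(n) x^n) = - Npoly(x), with Dpoly`_0 = -1 invertible *)
  (Dpoly`_0 = -1 :> int)%R /\
  (forall n : nat,
     (\sum_(k < n.+1) Dpoly`_k * ((a (n - k))%:Z) = - Npoly`_n :> int)%R) /\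
  (* the first 31 terms *)
  map (fun n => N.of_nat (a n)) (iota 0 31) =
    [:: 1; 1; 2; 4; 8; 16; 32; 64; 128; 256; 512; 1024; 2048; 4096; 8192;
        16384; 32768; 65536; 131072; 262143; 524281; 1048546; 2097050;
        4194001; 8387784; 16775108; 33549270; 67096623; 134189393;
        268371074; 536726740]%num /\
  (* growth constants *)
  exists r c : R,
    Rlt (Rabs (Rminus r r_printed)) tol /\
    Rlt (Rabs (Rminus c c_printed)) tol /\
    ((fun n : nat => Rdiv (INR (a n.+1)) (INR (a n))) @ \oo --> r)%classic /\
    ((fun n : nat => Rdiv (INR (a n)) (Rmult c (pow r n))) @ \oo --> (1 : R))%classic.
Proof.
split; first by rewrite DpolyE coef_Poly.
split; first exact: a_gf.
split.
  apply: first_terms => n; have := a_gf n; rewrite DpolyE NpolyE coef_Poly => <-.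
  by apply: eq_bigr => k _; rewrite coef_Poly.
have [x [xb Dx0]] := root_exists.
have [c sc] := weighted_a_cvg xb Dx0.
have cQ : Rmult c (Zhorner (map Z_of_int derivXcoefs) x) =
    Zhorner (map Z_of_int Ncoefs) x.
  rewrite -!horner_map_intr -Dpoly_derivX -NpolyE RmultE.
  rewrite rmorphM /= map_polyX -deriv_map (limit_at_root Dx0 a_cauchy sc).
  by rewrite /realize rmorphN hornerN opprK.
have cb := constant_bound xb cQ.
have x_neq0 : x != 0%R.
  by apply/eqP => x0; move: xb; rewrite x0 /x_lo /x_hi -R0E; Lra.lra.
(* The numerical enclosure keeps [c] away from 0, as both quotient limits require. *)
have c_neq0 : c != 0%R.
  apply/eqP => c0; move: cb; rewrite c0 /c_printed /tol -R0E => /Rabs_def2.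
  by Lra.lra.
exists (Rinv x), c; split; first exact: growth_rate_bound.
split; first exact: cb.
pose s n : R := ((a n)%:R * x ^+ n)%R.
split.
  have -> : (fun n => Rdiv (INR (a n.+1)) (INR (a n))) =
      (fun n => s n.+1 / s n * x^-1)%R.
    apply/funext => n; rewrite RdivE !INRE /s exprSr invfM.
    rewrite [RHS](_ : _ = ((a n.+1)%:R / (a n)%:R) * (x ^+ n / x ^+ n) * (x / x))%R; last by ring.
    by rewrite !divff ?expf_neq0 // !mulr1.
  have s1 : ((fun n => s n.+1) @ \oo --> c)%classic by rewrite cvg_shiftS.
  have -> : Rinv x = (c / c / x)%R by rewrite divff // mul1r.
  apply: cvgM; last exact: cvg_cst.
  by apply: cvgM; [exact: s1 | apply: cvgV].
have -> : (fun n => Rdiv (INR (a n)) (Rmult c (pow (Rinv x) n))) = (fun n => s n / c)%R.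
  apply/funext => n; rewrite RdivE RmultE INRE RpowE RinvE /s exprVn invfM invrK.
  by rewrite -mulrA [(c^-1 * _)%R]mulrC.
have -> : (1 : R) = (c / c)%R by rewrite divff.
by apply: cvgM; [exact: sc | exact: cvg_cst].
Qed.
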